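(* Let $L>0$ and $D>0$, and let $(\alpha_k)$, $(\beta_k)$ be positive sequences with $L\alpha_k=\Theta(k^{-1/2})$ and $\beta_k=\Theta(k^{-1})$ as $k\to\infty$. Consider the one-dimensional monotone $L$-Lipschitz operator $F:\mathbb R\to\mathbb R$, $F(z)=Lz$, the initial point $z_0=D$, and the deterministic iteration $$z_{k+1}=z_k-\alpha_kF(z_k)+\beta_k(z_0-z_k),\qquad k\ge0.$$ Then $$\|F(z_k)\|^2=\Omega\left(\frac{L^2D^2}{k}\right),$$ i.e. there exist $c>0$ and $K$ (depending on the sequences) such that $|F(z_k)|^2\ge cL^2D^2/k$ for all $k\ge K$. *)

(* Defs.v *)
From mathcomp Require Import all_boot all_order all_algebra.
From mathcomp Require Import all_classical all_reals all_analysis.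
Set Implicit Arguments.
Unset Strict Implicit.
Unset Printing Implicit Defensive.

Import Order.TTheory GRing.Theory Num.Theory.
Import numFieldNormedType.Exports.
Local Open Scope classical_set_scope.
Local Open Scope ring_scope.

Definition scaling_operator (R : realType) (L : R) : R -> R := fun z => L * z.

Lemma scaling_operator_monotone (R : realType) (L x y : R) : 0 <= L ->
  0 <= (scaling_operator L x - scaling_operator L y) * (x - y).
Proof.
by move=> L0; rewrite /scaling_operator -mulrBr -mulrA mulr_ge0 // -expr2 sqr_ge0.
Qed.

Lemma scaling_operator_lipschitz (R : realType) (L : R) : 0 <= L ->
  L.-lipschitz (scaling_operator L : R^o -> R^o).
Proof.
move=> L0 [x y] _ /=.
by rewrite /scaling_operator -mulrBr normrM (ger0_norm L0).
Qed.

Fixpoint anchored_iter (R : realType) (F : R -> R) (alpha beta : nat -> R)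
    (z0 : R) (k : nat) : R :=
  if k is j.+1 then
    let zj := anchored_iter F alpha beta z0 j in
    zj - alpha j * F zj + beta j * (z0 - zj)
  else z0.

(* Main.v *)
Require Import Defs.
From mathcomp Require Import all_boot all_order all_algebra.
From mathcomp Require Import all_classical all_reals all_analysis.
From mathcomp Require Import ring lra.
Set Implicit Arguments.
Unset Strict Implicit.
Unset Printing Implicit Defensive.

Import Order.TTheory GRing.Theory Num.Theory.
Import numFieldNormedType.Exports.
Local Open Scope classical_set_scope.
Local Open Scope ring_scope.

(** By linearity [z_k = D x_k] with [x_0 = 1] and
    [x_(k+1) = (1 - r_k) x_k + beta_k], where [r_k = L alpha_k + beta_k] is
    eventually at most [p / sqrt k] and [beta_k >= b / k].  While [x_k < 0] each
    step gains at least [b / k], so divergence of the harmonic series forces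
    [x_k >= 0] at some late [k], and then [x_(k+1) > 0].  From there on
    [x_k >= c / sqrt k] propagates as soon as [c p <= b], since
    [(1 - p / sqrt k) c / sqrt k + b / k >= c / sqrt k >= c / sqrt (k+1)]. *)

Lemma bigThetaW (R : realFieldType) (T : Type) (V : normedModType R)
    (F : filter_on T) (f g : T -> V) : f =Theta_F g ->
  exists a b : R, [/\ 0 < a, 0 < b &
    \forall x \near F, a * `|g x| <= `|f x| <= b * `|g x|].
Proof.
rewrite eqThetaE qualifE => /asboolP[[a b]] /= /andP[a0 b0] fg.
by exists a, b; split => //; apply: filterS fg => x [-> ->].
Qed.

(** If [x] stayed negative from [N] on, adding up the gains would bound the harmonic partial sums,
    which are nondecreasing, so they would converge. *)
Lemma harmonic_growth_ge0 (R : realType) (b : R) (x : R^nat) (N : nat) :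
  0 < b ->
  (forall k, (N <= k)%N -> x k < 0 -> x k + b / k%:R <= x k.+1) ->
  exists2 k, (N <= k)%N & 0 <= x k.
Proof.
move=> b0 xS; apply: contrapT => xneg.
have x_lt0 k : (N <= k)%N -> x k < 0.
  by move=> Nk; rewrite ltNge; apply/negP => xk; apply: xneg; exists k.
pose H : R^nat := series harmonic.
have HS n : H n.+1 = H n + n.+1%:R^-1 by rewrite /H /series/= big_nat_recr.
(* The last term of [H n] is [1/n], so the difference of partial sums collects [1/k] for
   [N < k <= N + n]; the telescoping therefore starts at [x N.+1]. *)
have gain n : b * (H (N + n)%N - H N) <= x (N + n).+1 - x N.+1.
  elim: n => [|n IHn]; first by rewrite addn0 !subrr mulr0.
  rewrite addnS HS addrAC mulrDr (le_trans (lerD IHn (lexx _)))// addrAC lerB//.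
  have Nk : (N <= (N + n).+1)%N := leqW (leq_addr _ _).
  exact: xS Nk (x_lt0 _ Nk).
apply: (@dvg_harmonic R).
(* This bound is [gain] with the negative term [x (N + n).+1] dropped. *)
apply: (@near_nondecreasing_is_cvgn _ _ (H N - x N.+1 / b)).
  apply: nearW => n m nm; apply: nondecreasing_series => // i _ _.
  exact: harmonic_ge0.
exists N => // n /= Nn; rewrite -/H.
have := gain (n - N)%N; rewrite subnKC// => gn.
have xn : x n.+1 < 0 by rewrite x_lt0// leqW.
rewrite -lerBlDl -mulNr ler_pdivlMr//; lra.
Qed.

(** The condition on [N] keeps the factor [1 - p / sqrt k] nonnegative for every later [k], so the
    induction bound can be substituted for [x k]. *)
Lemma inv_sqrt_lower_bound (R : rcfType) (b c p : R) (x : nat -> R) (N : nat) :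
  (0 < N)%N -> 0 <= c -> c * p <= b -> p <= Num.sqrt N%:R ->
  (forall k, (N <= k)%N -> 0 <= x k ->
    (1 - p / Num.sqrt k%:R) * x k + b / k%:R <= x k.+1) ->
  c / Num.sqrt N%:R <= x N ->
  forall k, (N <= k)%N -> c / Num.sqrt k%:R <= x k.
Proof.
move=> N0 c0 cpb pN xS xN; elim=> [|k IHk].
  by rewrite leqn0 => /eqP N00; rewrite N00 in N0.
rewrite leq_eqVlt => /predU1P[<-//|]; rewrite ltnS => Nk.
have {}IHk := IHk Nk.
have k0 : (0 : R) < k%:R by rewrite ltr0n (leq_trans N0).
set s := Num.sqrt k%:R in IHk *.
have s0 : 0 < s by rewrite sqrtr_gt0.
have xk0 : 0 <= x k by rewrite (le_trans _ IHk)// divr_ge0// ltW.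
apply: le_trans (xS _ Nk xk0); rewrite -/s.
have ps : p / s <= 1.
  by rewrite ler_pdivrMr// mul1r (le_trans pN)// /s ler_sqrt ?ler_nat.
apply: (@le_trans _ _ (c / s)).
  by rewrite /s ler_wpM2l// lef_pV2 ?posrE ?sqrtr_gt0 ?ltr0Sn// ler_sqrt ?ler_nat.
apply: (@le_trans _ _ ((1 - p / s) * (c / s) + b / k%:R)); last first.
  by rewrite lerD2r ler_wpM2l// subr_ge0.
have -> : k%:R = s ^+ 2 by rewrite sqr_sqrtr// ltW.
(* The contraction costs [c p / k], which [b / k] repays. *)
rewrite -subr_ge0.
have -> : (1 - p / s) * (c / s) + b / s ^+ 2 - c / s = (b - c * p) / s ^+ 2.
  by field; rewrite gt_eqF.
by rewrite divr_ge0 ?subr_ge0// sqr_ge0.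
Qed.

(** Linearity in the anchor lets constants found for the start [1] serve every [D]. *)
Lemma anchored_iter_scaling (R : realType) (L D : R) (alpha beta : nat -> R) k :
  anchored_iter (scaling_operator L) alpha beta D k =
  D * anchored_iter (scaling_operator L) alpha beta 1 k.
Proof.
elim: k => [|k IHk] /=; first by rewrite mulr1.
by rewrite IHk /scaling_operator; ring.
Qed.

Theorem lemmaB2 (R : realType) (L : R) (alpha beta : nat -> R)
  (L_gt0 : 0 < L)
  (alpha_gt0 : forall k, 0 < alpha k)
  (beta_gt0 : forall k, 0 < beta k)
  (alphaTheta : (fun k => L * alpha k : R^o)
     =Theta_\oo (fun k => k%:R `^ (- 2^-1) : R^o))
  (betaTheta : (beta : nat -> R^o) =Theta_\oo (fun k => k%:R^-1 : R^o)) :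
  exists (c : R) (K : nat), 0 < c /\
    forall D : R, 0 < D ->
    let F := scaling_operator L in
    let z := anchored_iter F alpha beta D in
    forall k : nat, (K <= k)%N ->
      c * (L ^+ 2 * D ^+ 2 / k%:R) <= `|F (z k)| ^+ 2.
Proof.
have [a' [a [_ a0 aN]]] := bigThetaW alphaTheta.
have [b [b' [b0 b'0 bN]]] := bigThetaW betaTheta.
(* [a] bounds the [L * alpha k] part; [b'] bounds [beta k], since [1/k <= 1/sqrt k] for [k >= 1]. *)
pose p := a + b'.
have p0 : 0 < p by rewrite addr_gt0.
have : \forall k \near \oo, [/\ (0 < k)%N, p <= Num.sqrt k%:R,
    b / k%:R <= beta k & L * alpha k + beta k <= p / Num.sqrt k%:R].
  near=> k.
  have k0 : (0 < k)%N by near: k; exact: nbhs_infty_gt.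
  have k1 : (1 : R) <= k%:R by rewrite ler1n.
  have s1 : 1 <= Num.sqrt k%:R :> R by rewrite -[leLHS]sqrtr1 ler_sqrt.
  have ps : p <= Num.sqrt k%:R.
    rewrite -[leLHS]ger0_norm ?(ltW p0)// -sqrtr_sqr ler_sqrt//.
    by near: k; exact: nbhs_infty_ger.
  have : b * `|k%:R^-1 : R^o| <= `|beta k : R^o| <= b' * `|k%:R^-1 : R^o|.
    by near: k.
  rewrite !ger0_norm ?invr_ge0 ?ler0n ?(ltW (beta_gt0 _))// => /andP[bk b'k].
  have /andP[_] : a' * `|k%:R `^ (- 2^-1) : R^o| <= `|L * alpha k : R^o|
      <= a * `|k%:R `^ (- 2^-1) : R^o| by near: k; exact: aN.
  rewrite powRN powR12_sqrt// !ger0_norm ?invr_ge0 ?sqrtr_ge0//; last first.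
    by rewrite mulr_ge0// ltW.
  move=> ak; split => //.
  rewrite mulrDl lerD// (le_trans b'k)// ler_pM2l// lef_pV2 ?posrE ?ltr0n//.
    by rewrite -[leRHS]sqr_sqrtr// expr2 ler_peMl// (le_trans _ s1).
  by rewrite (lt_le_trans _ s1).
case=> N _ HN.
pose x := anchored_iter (scaling_operator L) alpha beta 1.
have xS k : x k.+1 = (1 - (L * alpha k + beta k)) * x k + beta k.
  by rewrite /x /= /scaling_operator; ring.
have [j Nj xj] : exists2 k, (N <= k)%N & 0 <= x k.
  apply: (harmonic_growth_ge0 b0) => k /HN[_ _ bk _] xk; rewrite xS.
  have rk : 0 <= L * alpha k + beta k.
    by rewrite addr_ge0 ?mulr_ge0 ?(ltW (alpha_gt0 _)) ?(ltW (beta_gt0 _)) ?ltW.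
  (* For negative [x k] the contraction pushes upwards, so the gain is at least [beta k]. *)
  have : (L * alpha k + beta k) * x k <= 0 by rewrite mulr_ge0_le0// ltW.
  lra.
have xS_ge k : (N <= k)%N -> 0 <= x k ->
    (1 - p / Num.sqrt k%:R) * x k + b / k%:R <= x k.+1.
  by move=> /HN[_ _ bk rk] xk; rewrite xS lerD// ler_wpM2r// lerD2l lerN2.
have Nj1 : (N <= j.+1)%N := leqW Nj.
have [_ psj _ _] := HN _ Nj1.
(* [x j] may vanish, which would force [c = 0]; one more step adds [b / j > 0]. *)
have xj1 : 0 < x j.+1.
  have [j0 pj _ _] := HN _ Nj; apply: lt_le_trans (xS_ge _ Nj xj).
  rewrite ltr_wpDl ?divr_gt0 ?ltr0n// mulr_ge0// subr_ge0.
  by rewrite ler_pdivrMr ?mul1r// sqrtr_gt0 ltr0n.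
(* The first entry gives [c * p <= b], the second the base case at [j.+1]. *)
pose c := Num.min (b / p) (Num.sqrt j.+1%:R * x j.+1).
have c0 : 0 < c by rewrite lt_min divr_gt0// mulr_gt0// sqrtr_gt0 ltr0n.
have x_ge k : (j.+1 <= k)%N -> c / Num.sqrt k%:R <= x k.
  apply: (@inv_sqrt_lower_bound _ b _ p) => //; first exact: ltW.
  - by rewrite -ler_pdivlMr// ge_min lexx.
  - by move=> i ji; apply: xS_ge; exact: leq_trans ji.
  - by rewrite ler_pdivrMr ?sqrtr_gt0 ?ltr0n// mulrC ge_min lexx orbT.
exists (c ^+ 2), j.+1; split; first by rewrite exprn_gt0.
move=> D D0 F z k jk.
rewrite /z anchored_iter_scaling -/F -/x /F /scaling_operator real_normK ?num_real//.
rewrite !exprMn [leRHS]mulrA.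
have -> : c ^+ 2 * (L ^+ 2 * D ^+ 2 / k%:R) =
  L ^+ 2 * D ^+ 2 * (c / Num.sqrt k%:R) ^+ 2.
  by rewrite expr_div_n sqr_sqrtr ?ler0n//; ring.
have ck0 : 0 <= c / Num.sqrt k%:R by rewrite divr_ge0 ?sqrtr_ge0// ltW.
apply: ler_wpM2l; first by rewrite mulr_ge0 ?sqr_ge0.
by rewrite lerXn2r ?nnegrE ?x_ge// (le_trans ck0) ?x_ge.
Unshelve. all: by end_near. Qed.
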